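(* Let $\Psi$ be a finite (possibly empty) composition of $U$ and $V$, let $\Psi(ab)=\Pi_1\Pi_2$ be its unique factorization into two nonempty palindromes, and put $\Pi=\Pi_1\Pi_2$. For an integer $k\ge1$ let $r^{\Psi}_k=\rho_{C}$ where $C$ is the chain $\Pi_2\Pi^k$ (i.e. $\Pi_2$ followed by $k$ copies of $\Pi$). Write the chain of $\Pi$ as $[p_1\dots p_m]$ and the chain of $\Pi_2\Pi^{k-1}$ as $[c_1\dots c_l]$. Then $$\mathcal{Z}(r^{\Psi}_k)=\Big([p_1;p_2,\dots,p_m]+[0;c_1,c_2,\dots,c_l]\Big)^{-1}.$$
   Context: Write $a=[22]$ and $b=[11]$; a word in $a,b$ is identified with the chain (finite sequence of positive integers) obtained by concatenation. For a chain $S=[s_1\dots s_m]$, $\rho_S=[0;s_1,\dots,s_m]$ and $[s_1;s_2,\dots,s_m]=1/\rho_S$ are finite continued fractions. For a rational $x=p/q$ in lowest terms with $q\ge2$, $\mathcal{Z}(x)=\min_{0<q'<q}q'\|q'x\|$, $\|\cdot\|$ being distance to the nearest integer; equivalently, if $x=[0;a_1,\dots,a_n]$ then $\mathcal{Z}(x)=\big(\max_{1\le i\le n}([a_i;a_{i+1},\dots,a_n]+[0;a_{i-1},\dots,a_1])\big)^{-1}$. The Nielsen moves are the substitutions $U:a\mapsto ab,\ b\mapsto b$ and $V:a\mapsto a,\ b\mapsto ab$. *)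

(* Defs.v *)
From HB Require Import structures.
From mathcomp Require Import all_boot all_order all_algebra.
Set Implicit Arguments. Unset Strict Implicit. Unset Printing Implicit Defensive.
Import Order.TTheory GRing.Theory Num.Theory.
Local Open Scope ring_scope.

Inductive letter := La | Lb.
Definition word := seq letter.

Definition palindrome (w : word) : Prop := rev w = w.

Definition chain_of (w : word) : seq nat :=
  flatten (map (fun l => match l with La => [:: 2%N; 2%N] | Lb => [:: 1%N; 1%N] end) w).

Inductive move := MU | MV.
Definition apply_move (m : move) (w : word) : word :=
  flatten (map (fun l => match m, l with
                         | MU, La => [:: La; Lb]
                         | MU, Lb => [:: Lb]
                         | MV, La => [:: La]
                         | MV, Lb => [:: La; Lb]
                         end) w).

Definition Psi (ms : seq move) (w : word) : word := foldr apply_move w ms.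

Fixpoint cf0 (s : seq nat) : rat :=
  match s with [::] => 0 | x :: t => (x%:R + cf0 t)^-1 end.
Definition cfi (s : seq nat) : rat :=
  match s with [::] => 0 | x :: t => x%:R + cf0 t end.

Definition dnear (x : rat) : rat :=
  Num.min (x - (Num.floor x)%:~R) ((Num.floor x + 1)%:~R - x).

(* Z(x) = min_{0 < q' < q} q' ||q' x||, q the (reduced) denominator of x;
   the neutral value 1 is irrelevant when q >= 2 since 1*||x|| <= 1/2. *)
Definition Zval (x : rat) : rat :=
  \big[Num.min/1]_(1 <= q' < `|denq x|%N) (q'%:R * dnear (q'%:R * x)).

(* Main.v *)
Require Import Defs.
From mathcomp Require Import all_boot all_order all_algebra.
From mathcomp Require Import ring lra zify.
Import Order.TTheory GRing.Theory Num.Theory.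
Local Open Scope ring_scope.
Set Implicit Arguments. Unset Strict Implicit.

(* Order words lexicographically with a < b, a prefix being smaller. Since both
   letters have even length, w |-> [0; w] is increasing. Let C = Pi_2 Pi^k. Every
   proper nonempty suffix W of C satisfies Pi <= W <= Pi_2 Pi^(k-1): this is clear
   for Psi = id, and passes through U and V because these are increasing and
   transform C into b U(C) and a^-1 V(C). As C is a palindrome, the reversals of
   its proper prefixes obey the same upper bound. A cut of C just before a letter
   a, C = X a Y, has value 2 + 1/(2 + [0; Y]) + [0; rev X], so all such values are
   at most the one with a Y = Pi and rev X = Pi_2 Pi^(k-1), and the cuts inside a
   letter b are too small to matter. Finally, the minimum of q'||q'x|| is attained
   at a convergent by the usual best approximation argument. *)

(** * Cutting the image of a word *)

Lemma flatten_map_split (S T : Type) (f : S -> seq T) (w : seq S) (x y : seq T) :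
  flatten (map f w) = x ++ y -> y <> [::] ->
  exists x1 l y1 u v, [/\ w = x1 ++ l :: y1, f l = u ++ v, v <> [::],
    x = flatten (map f x1) ++ u & y = v ++ flatten (map f y1)].
Proof.
elim: w x => [|l w IH] x /=; first by case: x => // ->.
move=> E y0.
(* The letter [l] is the one whose image contains the first symbol of [y], so [u] may be empty but
   [v] may not. *)
have [lt|le] := ltnP (size x) (size (f l)).
  have Ex : take (size x) (f l) = x.
    have := congr1 (take (size x)) E.
    by rewrite !take_cat lt ltnn subnn take0 cats0.
  exists [::], l, w, (take (size x) (f l)), (drop (size x) (f l)).
  split=> //; first by rewrite cat_take_drop.
    move=> D0; have := congr1 size D0; rewrite size_drop /=; lia.
  have := congr1 (drop (size x)) E.
  by rewrite !drop_cat lt ltnn subnn drop0.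
have Ex : x = f l ++ drop (size (f l)) x.
  rewrite -{1}(cat_take_drop (size (f l)) x); congr (_ ++ _).
  have := congr1 (take (size (f l))) E.
  by rewrite take_cat ltnn subnn take0 cats0 takel_cat.
have /(IH _)/(_ y0) : flatten (map f w) = drop (size (f l)) x ++ y.
  have E' : f l ++ flatten (map f w) = f l ++ (drop (size (f l)) x ++ y).
    by rewrite catA -Ex.
  by have := congr1 (drop (size (f l))) E'; rewrite !drop_size_cat.
case=> x1 [m [y1 [u [v [-> fm v0 Ed ->]]]]].
by exists (l :: x1), m, y1, u, v; split=> //=; rewrite Ex Ed catA.
Qed.

(** * The lexicographic order, the Nielsen moves and palindromes *)

Fixpoint lew (u v : word) : bool :=
  match u, v with
  | [::], _ => true
  | _ :: _, [::] => false
  | La :: u', La :: v' => lew u' v'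
  | Lb :: u', Lb :: v' => lew u' v'
  | La :: _, Lb :: _ => true
  | Lb :: _, La :: _ => false
  end.

Lemma lew_trans (v u w : word) : lew u v -> lew v w -> lew u w.
Proof. by elim: v u w => [|[] v IH] [|[] u] [|[] w] //=; apply: IH. Qed.

Local Notation U := (apply_move MU).
Local Notation V := (apply_move MV).

Lemma apply_move_cat (m : move) (u v : word) :
  apply_move m (u ++ v) = apply_move m u ++ apply_move m v.
Proof. by rewrite /apply_move map_cat flatten_cat. Qed.

Lemma apply_move_pow (m : move) (k : nat) (w : word) :
  apply_move m (flatten (nseq k w)) = flatten (nseq k (apply_move m w)).
Proof. by elim: k => //= k IH; rewrite apply_move_cat IH. Qed.

Lemma apply_move_split (m : move) (w x y : word) :
  apply_move m w = x ++ y -> y <> [::] ->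
  exists x1 l y1, w = x1 ++ l :: y1 /\
    ((x = apply_move m x1 /\ y = apply_move m (l :: y1)) \/
     [/\ apply_move m [:: l] = [:: La; Lb], x = rcons (apply_move m x1) La
       & y = Lb :: apply_move m y1]).
Proof.
move=> E y0; have [x1 [l [y1 [u [v [-> El v0 -> ->]]]]]] := flatten_map_split E y0.
exists x1, l, y1; split=> //.
case: u El => [|u0 [|u1 u]] El.
- by left; rewrite cats0 -[v]/([::] ++ v) -El.
- right; case: v v0 El => [|v1 v] // _ El; rewrite cats1.
  by case: m l El {E} => [] [] //= [] <- <- <-.
- by case: v v0 El => // v1 v _; case: m l {E} => [] [] [] //; case: u.
Qed.

Lemma U_inj : injective U.
Proof. by elim=> [|[] u IH] [|[] v] //= []; move/IH->. Qed.

Lemma V_inj : injective V.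
Proof.
elim=> [|[] u IH] [|[] v] //= []; try by move/IH->.
- by case: u {IH} => [|[]].
- by case: v => [|[]].
Qed.

Lemma lew_U (u v : word) : lew u v -> lew (U u) (U v).
Proof. by elim: u v => [|[] u IH] [|[] v] //=; apply: IH. Qed.

(** When [a] meets [b], the images are [a V(u)] and [a b V(v)]; since [V(u)] is empty or begins with
    [a], the order survives. *)
Lemma lew_V (u v : word) : lew u v -> lew (V u) (V v).
Proof.
elim: u v => [|[] u IH] [|[] v] //=; try exact: IH.
by case: u {IH} => [|[]].
Qed.

(** Conjugating [U] by [b] turns it into its mirror image [a -> ba]. With injectivity this pulls
    palindromes back through [U]; [V_conj] does the same for [V]. *)
Lemma U_conj (w : word) : Lb :: U w = rcons (rev (U (rev w))) Lb.
Proof.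
elim: w => [|x w IH] //.
rewrite rev_cons -(cats1 (rev w)) apply_move_cat rev_cat rcons_cat -IH.
by case: x.
Qed.

Lemma V_conj (w : word) : rcons (V w) La = La :: rev (V (rev w)).
Proof.
elim: w => [|x w IH] //.
rewrite rev_cons -(cats1 (rev w)) apply_move_cat rev_cat.
rewrite -(cat1s x w) apply_move_cat rcons_cat IH.
by case: x.
Qed.

Lemma palindrome_U (w : word) : palindrome (Lb :: U w) -> palindrome w.
Proof.
rewrite /palindrome rev_cons -{1}(revK w) -U_conj => -[] /U_inj.
exact.
Qed.

Lemma palindrome_V (w : word) : palindrome (rcons (V w) La) -> palindrome w.
Proof.
rewrite /palindrome rev_rcons -{1}(revK w) -V_conj.
by case/rcons_inj=> /V_inj.
Qed.

(** * Bounds on the suffixes of Pi_2 Pi^k *)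

Definition suffixes_between (C lo hi : word) : Prop :=
  forall X W, C = X ++ W -> X <> [::] -> W <> [::] -> lew lo W && lew W hi.

(** A suffix beginning with [b] is [b U(Y)] with [Y] an old suffix, whose upper bound it inherits;
    one beginning with [a] is [U(a Y)] and inherits the lower bound. The first letter settles the
    other bound. *)
Lemma suffixes_between_U (C lo hi : word) :
  suffixes_between (Lb :: C) (La :: lo) hi ->
  suffixes_between (Lb :: U (Lb :: C)) (U (La :: lo)) (Lb :: U hi).
Proof.
move=> H [|x X] W // [_ E] _ W0.
have [X1 [l [Y [EC EW]]]] := apply_move_split E W0.
have HY : lew Y hi.
  have X10 : rcons X1 l <> [::] by case: X1 {EC EW}.
  case: Y EC EW => // y Y EC EW.
  by have /andP[] : lew (La :: lo) (y :: Y) && lew (y :: Y) hi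
    by apply: (H (rcons X1 l)); rewrite ?cat_rcons.
case: EW => [[_ ->]|[_ _ ->]]; last exact: lew_U.
case: l EC => EC; last exact: lew_U.
have X10 : X1 <> [::] by move=> X10; rewrite X10 in EC.
have /andP[H1 _] : lew (La :: lo) (La :: Y) && lew (La :: Y) hi by exact: H EC X10 _.
by rewrite (lew_U H1).
Qed.

(** Suffixes are now [V(l Y)], below [hi'] because [hi'] begins with [b], or [b V(Y)], whose upper
    bound is that on [V(b Y)] with the leading [a] removed. *)
Lemma suffixes_between_V (C C' lo hi hi' : word) :
  V (Lb :: C) = La :: C' -> V (Lb :: hi) = La :: hi' ->
  suffixes_between (Lb :: C) lo (Lb :: hi) -> (exists lo', lo = La :: lo') ->
  suffixes_between C' (V lo) hi'.
Proof.
move=> EC Ehi H [lo' Elo] X W EX X0 W0; rewrite EX -cat_cons in EC.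
have [X1 [l [Y [{}EC EW]]]] := apply_move_split EC W0.
have X10 : X1 <> [::].
  case: X X0 EX EW => // x X _ EX EW X10; move: EW; rewrite X10.
  by case=> [[]|[]].
have /andP[H1 H2] : lew lo (l :: Y) && lew (l :: Y) (Lb :: hi) by exact: H EC X10 _.
case: EW => [[_ ->]|[]].
  rewrite (lew_V H1) /=; case: Ehi => <-.
  by case: l {EC H1 H2}.
case: l EC H1 H2 => // EC H1 H2 _ _ ->.
rewrite Elo /=; move: (lew_V H2); rewrite Ehi.
exact.
Qed.

Lemma Psi_ends (ms : seq move) :
  exists w, Psi ms [:: La; Lb] = La :: rcons w Lb.
Proof.
elim: ms => [|m ms [w IH]]; first by exists [::].
rewrite /= -/(Psi ms _) IH -cats1 -cat1s !apply_move_cat.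
case: m; first by exists (Lb :: U w); rewrite -cats1.
by exists (rcons (V w) La); rewrite -!cats1 -catA.
Qed.

Lemma palindrome_ends (P Q w : word) :
  P ++ Q = La :: rcons w Lb -> P <> [::] -> Q <> [::] ->
  palindrome P -> palindrome Q ->
  [/\ exists P', P = La :: P', exists P', P = rcons P' La
    & exists Q', Q = Lb :: Q'].
Proof.
move=> E P0 Q0 HP HQ.
have [P' EP] : exists P', P = La :: P'.
  by case: P P0 E {HP} => // x P _ [-> _]; exists P.
split; first by exists P'.
  by exists (rev P'); rewrite -rev_cons -EP HP.
case/lastP: Q Q0 HQ E => // Q x _ HQ.
rewrite -rcons_cat -rcons_cons => /rcons_inj[_ Ex]; rewrite Ex in HQ *.
by exists (rev Q); rewrite -rev_rcons HQ.
Qed.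

Lemma Psi_palindromes_between (ms : seq move) (P Q : word) (k : nat) :
  P ++ Q = Psi ms [:: La; Lb] ->
  P <> [::] -> Q <> [::] -> palindrome P -> palindrome Q ->
  suffixes_between (Q ++ flatten (nseq k.+1 (P ++ Q))) (P ++ Q)
    (Q ++ flatten (nseq k (P ++ Q))).
Proof.
elim: ms P Q => [|m ms IH] P Q E P0 Q0 HP HQ.
  case: P P0 E HP => // x [|x1 P] _ E _; last first.
    by case: E Q0 => _ _; case: P => //= ->.
  case: E => -> -> {x Q Q0 HQ}.
  have lo_hi (j : nat) : lew (Lb :: flatten (nseq j [:: La; Lb]))
      (Lb :: flatten (nseq j.+1 [:: La; Lb])) by elim: j.
  elim: k => [|k IH] X W.
    case: X => // x [|x1 [|x2 X]] EX _ W0.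
    - by case: EX => _ <-.
    - by case: EX => _ _ <-.
    - by case: EX W0 => _ _ _; case: X => //= <-.
  case: X => // x [|x1 [|x2 X]] EX _ W0.
  - by case: EX => _ <-.
  - case: EX => _ _ <- /=.
    by elim: k {IH}.
  (* Dropping [b a] from the front of b(ab)^(k+2) leaves the word of the previous [k], so the
     induction applies with a smaller upper bound. *)
  - have /andP[-> H] : lew [:: La; Lb] W && lew W (Lb :: flatten (nseq k [:: La; Lb])).
      by apply: (IH (x2 :: X)) => //; rewrite /=; case: EX => _ _ <- <-.
    exact: lew_trans H (lo_hi k).
have [w Ew] := Psi_ends (m :: ms); have [w' Ew'] := Psi_ends ms.
rewrite Ew in E.
have [_ [P'' EP'] [Q' EQ]] := palindrome_ends E P0 Q0 HP HQ.
rewrite -Ew in E.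
have [X1 [l [Y [EC EW]]]] := apply_move_split (w := Psi ms [:: La; Lb]) (esym E) Q0.
(* The cut between [P] and [Q] cannot separate two images: [Q] begins with [b], which excludes [V],
   and under [U] the prefix [U(X1)] would end with [b], whereas [P] ends with [a]. *)
case: EW => [[EP2 EQ2]|[El EP2 EQ2]].
  case: m {Ew E} EP2 EQ2 => EP2 EQ2; last by case: l {EC} EQ2; rewrite EQ.
  case: l {EC} EQ2; first by rewrite EQ.
  have := U_conj X1; rewrite -EP2 EP' -rcons_cons => /rcons_inj[] //.
rewrite EQ2 EP2 in HP HQ *.
rewrite EC in IH Ew'.
(* So the cut splits an image [ab], coming from [a] under [U] and from [b] under [V]. The earlier
   factorization is [X1 a | Y], respectively [X1 | b Y]. *)
case: m {E Ew} El EP2 EQ2 HP HQ => El EP2 EQ2 HP HQ.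
  case: l El EC Ew' IH => // _ EC; rewrite -cat_rcons => Ew' IH.
  have HY := palindrome_U HQ.
  have HX : palindrome (rcons X1 La).
    (* Here [b U(X1 a)] is the palindrome [P] enclosed between two letters [b]; likewise [V(b Y) a]
       below is [a Q a]. *)
    apply: palindrome_U; rewrite -cats1 apply_move_cat /= /palindrome.
    have -> : Lb :: U X1 ++ [:: La; Lb] = Lb :: rcons (rcons (U X1) La) Lb.
      by rewrite -!cats1 -catA.
    by rewrite rev_cons rev_rcons HP -rcons_cons.
  have [//||[x Ex] _ [y Ey]] := palindrome_ends Ew' _ _ HX HY.
  - by case: (X1).
  - by move=> Y0; move: Ew'; rewrite Y0 cats0 -rcons_cons => /rcons_inj [].
  have X0 : rcons X1 La <> [::] by rewrite Ex.
  have Y0 : Y <> [::] by rewrite Ey.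
  have {}IH := IH _ _ erefl X0 Y0 HX HY.
  have -> : rcons (U X1) La ++ Lb :: U Y = U (rcons X1 La ++ Y).
    by rewrite -!cats1 !apply_move_cat -!catA.
  rewrite -!apply_move_pow !cat_cons -!apply_move_cat.
  by move: IH; rewrite Ey Ex; apply: suffixes_between_U.
case: l El EC Ew' IH => // _ EC Ew' IH.
have HX := palindrome_V HP.
have HY : palindrome (Lb :: Y).
  apply: palindrome_V; rewrite /palindrome /=.
  by rewrite rev_cons -rcons_cons rev_rcons HQ.
have X0 : X1 <> [::] by move=> X0; rewrite X0 in Ew'.
have Y0 : Lb :: Y <> [::] by [].
have {}IH := IH _ _ erefl X0 Y0 HX HY.
have EV : rcons (V X1) La ++ Lb :: V Y = V (X1 ++ Lb :: Y).
  by rewrite -!cats1 !apply_move_cat -!catA.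
have EVC j : V (Lb :: Y ++ flatten (nseq j (X1 ++ Lb :: Y))) =
    La :: (Lb :: V Y) ++ flatten (nseq j (rcons (V X1) La ++ Lb :: V Y)).
  by rewrite EV -apply_move_pow cat_cons -apply_move_cat.
rewrite EV.
rewrite EV in EVC.
apply: (suffixes_between_V (EVC k.+1) (EVC k) IH).
by rewrite Ew'; exists (rcons w' Lb).
Qed.

(** * Continuants, best approximation and the evaluation of Z *)

Fixpoint den (s : seq nat) : nat :=
  if s is c :: t then (c * den t + (if t is _ :: t' then den t' else 0))%N else 1%N.
(** [den] is the continuant, and its inner [match] is [num] of the tail. The value 0 at the empty
    chain keeps [den_cons] uniform. *)
Definition num (s : seq nat) : nat := if s is _ :: t then den t else 0%N.

Lemma den_cons (c : nat) (s : seq nat) : den (c :: s) = (c * den s + num s)%N.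
Proof. by []. Qed.

Lemma num_cons (c : nat) (s : seq nat) : num (c :: s) = den s.
Proof. by []. Qed.

Lemma den_gt0 (s : seq nat) : all (leq 1) s -> (0 < den s)%N.
Proof.
by elim: s => // c s IH /andP[c0 /IH s0]; rewrite den_cons addn_gt0 muln_gt0 c0 s0.
Qed.

Lemma coprime_num_den (s : seq nat) : coprime (num s) (den s).
Proof.
elim: s => // c s IH.
by rewrite num_cons den_cons coprime_sym /coprime gcdnC gcdnMDl gcdnC.
Qed.

Lemma cf0_num_den (s : seq nat) : all (leq 1) s -> cf0 s = (num s)%:R / (den s)%:R.
Proof.
elim: s => [|c s IH] /=; first by rewrite mul0r.
move=> /andP[c0 s0]; rewrite IH // -/(den (c :: s)) den_cons.
have d0 : (den s)%:R != 0 :> rat by rewrite pnatr_eq0 -lt0n den_gt0.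
have d1 : (c * den s + num s)%:R != 0 :> rat.
  by rewrite -den_cons pnatr_eq0 -lt0n den_gt0 //= c0.
rewrite natrD natrM in d1 *.
by field; rewrite d0 d1.
Qed.

Lemma denq_cf0 (s : seq nat) : all (leq 1) s -> `|denq (cf0 s)|%N = den s.
Proof.
move=> s0; rewrite cf0_num_den //.
have -> : (num s)%:R / (den s)%:R = fracq ((num s)%:Z, (den s)%:Z).
  by rewrite fracqE.
have d0 := den_gt0 s0.
rewrite den_fracq /= -lt0n d0 /=.
by rewrite (eqP (coprime_num_den s)) divn1.
Qed.

(* At the cut [L | R] of a chain ([L] reversed), with convergents v' and v on
   its two sides, [qcoord L s t] is the denominator of the lattice vector
   s v' + t v, and [ecoord R s t] is, up to sign, its error q' x - p'
   multiplied by the denominator of the whole chain. *)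
Definition qcoord (L : seq nat) (s t : int) : int := (num L)%:Z * s + (den L)%:Z * t.
Definition ecoord (R : seq nat) (s t : int) : int := (den R)%:Z * s - (num R)%:Z * t.

(** Passing [c] replaces the two convergents by the next pair, so the same vector gets coordinates
    [(t - c s, s)]; in [ecoord_step] the sign alternates. *)
Lemma qcoord_step (L : seq nat) (c : nat) (s t : int) :
  qcoord (c :: L) (t - c%:Z * s) s = qcoord L s t.
Proof. by rewrite /qcoord num_cons den_cons PoszD PoszM; ring. Qed.

Lemma ecoord_step (R : seq nat) (c : nat) (s t : int) :
  ecoord R (t - c%:Z * s) s = - ecoord (c :: R) s t.
Proof. by rewrite /ecoord num_cons den_cons PoszD PoszM; ring. Qed.

Lemma den_catrev (L R : seq nat) :
  den (catrev L R) = (den L * den R + num L * num R)%N.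
Proof.
elim: L R => [|c L IH] R /=; first by rewrite mul1n mul0n addn0.
by rewrite IH -/(den (c :: L)) -/(den (c :: R)) !num_cons !den_cons; ring.
Qed.

(** The cut moves right until the denominator of the vector lies between two consecutive convergent
    denominators; there its error is at least that of the earlier convergent. *)
Lemma qcoord_ecoord_ge (L R : seq nat) (s t : int) :
  all (leq 1) L -> all (leq 1) R ->
  (den L)%:Z <= qcoord L s t < (den (catrev L R))%:Z ->
  exists L' c R', catrev L' (c :: R') = catrev L R /\
    (den L' * den R')%:Z <= qcoord L s t * `|ecoord R s t|.
Proof.
elim: R L s t => [|c R IH] L s t L0 R0 /andP[lo hi].
  by rewrite den_catrev /= muln0 muln1 addn0 ltNge lo in hi.
rewrite -(qcoord_step L c) in lo hi *.
rewrite -normrN -ecoord_step.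
move: {t}(t - c%:Z * s : int) lo hi => t lo hi.
have /andP[c0 {}R0] := R0.
have cL0 : all (leq 1) (c :: L) by rewrite /= c0.
have [le|lt] := leP (den (c :: L))%:Z (qcoord (c :: L) t s).
  by apply: (IH (c :: L) t s cL0 R0); rewrite le.
exists L, c, R; split=> //.
rewrite PoszM ler_pM //.
have dL : 0 < (den L)%:Z := den_gt0 L0.
have dcL : (den L)%:Z <= (den (c :: L))%:Z by rewrite den_cons; nia.
rewrite /qcoord num_cons in lo lt; rewrite /ecoord.
move: (den L)%:Z (den _)%:Z dL dcL lo lt => d d' d0 dd' lo lt.
(* The bounds on the denominator force [t] to be nonzero and, when [s] is nonzero, of opposite sign;
   the two terms of the error then reinforce each other. *)
have [s0|s0|s0] := ltgtP s 0.
- have t1 : 1 <= t by nia.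
  rewrite ger0_norm; nia.
- have t1 : t <= -1 by nia.
  rewrite ler0_norm; nia.
- have t1 : 1 <= t by nia.
  rewrite s0 mulr0 subr0 ger0_norm; nia.
Qed.

(** The change of basis at each step is unimodular, so integer coordinates at any cut can be carried
    back to the left end. *)
Lemma coords_exist (L R : seq nat) (s t : int) :
  exists s' t', t' = qcoord L s t /\
   `|ecoord (catrev L R) s' t'| = `|ecoord R s t|.
Proof.
elim: L R s t => [|c L IH] R s t /=.
  by exists s, t; rewrite /qcoord /= mul0r mul1r add0r.
have [s' [t' [Et Ee]]] := IH (c :: R) t (s + c%:Z * t).
exists s', t'; split.
  by rewrite Et -(qcoord_step L c) addrK.
by rewrite Ee -normrN -ecoord_step addrK.
Qed.

Lemma dnear_le (x : rat) (n : int) : dnear x <= `|x - n%:~R|.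
Proof.
have /andP[lo hi] := floor_itv x.
rewrite /dnear; have [nx|xn] := leP n (Num.floor x).
  rewrite ge_min; apply/orP; left.
  have : n%:~R <= (Num.floor x)%:~R :> rat by rewrite ler_int.
  by move=> H; rewrite ger0_norm; lra.
rewrite ge_min; apply/orP; right.
have : (Num.floor x + 1)%:~R <= n%:~R :> rat by rewrite ler_int; lia.
by move=> H; rewrite ler0_norm; lra.
Qed.

Lemma dnear_attained (x : rat) : exists n : int, dnear x = `|x - n%:~R|.
Proof.
have /andP[lo hi] := floor_itv x.
rewrite /dnear; case: leP => _.
  by exists (Num.floor x); rewrite ger0_norm; lra.
by exists (Num.floor x + 1); rewrite ler0_norm; lra.
Qed.

Lemma split_value (L R : seq nat) (c : nat) :
  all (leq 1) L -> all (leq 1) R ->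
  c%:R + cf0 R + cf0 L = (den (catrev L (c :: R)))%:R / (den L * den R)%:R.
Proof.
move=> L0 R0; rewrite den_catrev den_cons num_cons !cf0_num_den //.
have dL : (den L)%:R != 0 :> rat by rewrite pnatr_eq0 -lt0n den_gt0.
have dR : (den R)%:R != 0 :> rat by rewrite pnatr_eq0 -lt0n den_gt0.
by rewrite !(natrD, natrM); field; rewrite dL dR.
Qed.

Lemma Zval_term (s : seq nat) (m : int) (n : nat) :
  all (leq 1) s ->
  n%:R * `|n%:R * cf0 s - m%:~R| = (n%:Z * `|ecoord s m n%:Z|)%:~R / (den s)%:R :> rat.
Proof.
move=> s0; rewrite cf0_num_den //.
have dgt : 0 < (den s)%:R :> rat by rewrite ltr0n den_gt0.
have d0 : (den s)%:R != 0 :> rat by rewrite gt_eqF.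
have -> : n%:R * ((num s)%:R / (den s)%:R) - m%:~R = - (ecoord s m n%:Z)%:~R / (den s)%:R :> rat.
  by rewrite /ecoord rmorphB !rmorphM /= -!pmulrn; field.
by rewrite normrM normfV (gtr0_norm dgt) normrN rmorphM /= -intr_norm -!pmulrn mulrA.
Qed.

Lemma Zval_cf0 (s : seq nat) (M : rat) :
  all (leq 1) s ->
  (forall L c R, s = catrev L (c :: R) -> c%:R + cf0 R + cf0 L <= M) ->
  (exists L c R, [/\ s = catrev L (c :: R), (1 < c)%N & M = c%:R + cf0 R + cf0 L]) ->
  Zval (cf0 s) = M^-1.
Proof.
move=> s0 ub [L0 [c0 [R0 [Es c1 EM]]]].
have splitP L c R : s = catrev L (c :: R) -> all (leq 1) L /\ all (leq 1) R.
  by move=> E; move: s0; rewrite E catrevE all_cat all_rev /= => /andP[-> /andP[_ ->]].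
have dpos u : all (leq 1) u -> 0 < (den u)%:R :> rat by move=> u0; rewrite ltr0n den_gt0.
have [L0p R0p] := splitP _ _ _ Es.
have M0 : 0 < M.
  by rewrite EM split_value // -Es natrM divr_gt0 ?mulr_gt0 ?dpos.
rewrite /Zval denq_cf0 //; apply/eqP; rewrite eq_le; apply/andP; split.
  (* The coordinates [(0, 1)] are those of the convergent with denominator [den L0], whose error is
     [den R0]. *)
  have [m [n [En Ee]]] := coords_exist L0 (c0 :: R0) 0 1.
  rewrite /qcoord mulr0 add0r mulr1 in En.
  rewrite /ecoord mulr0 sub0r mulr1 num_cons normrN -Es En in Ee.
  (* The strict inequality comes from [c0 >= 2]. *)
  have lt : (1 <= den L0 < den s)%N.
    rewrite den_gt0 // Es den_catrev den_cons num_cons.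
    have := leq_mul c1 (den_gt0 R0p); have := den_gt0 L0p; nia.
  apply: (@le_trans _ _ ((den L0)%:R * dnear ((den L0)%:R * cf0 s))).
    have /andP[le1 lt1] := lt.
    apply: (le_trans (le_bigmin_nat _ _ le1 lt1)).
    by rewrite big_ltn // ge_min lexx.
  apply: (@le_trans _ _ ((den L0)%:R * `|(den L0)%:R * cf0 s - m%:~R|)).
    by rewrite ler_wpM2l // dnear_le.
  rewrite Zval_term // Ee EM split_value // -Es invf_div.
  by rewrite rmorphM /= ger0_norm // -!pmulrn natrM.
have cf0_ge0 u : all (leq 1) u -> 0 <= cf0 u.
  by move=> u0; rewrite cf0_num_den // divr_ge0.
rewrite big_nat; apply: le_bigmin => [|n /andP[n1 ns]].
  (* The default value 1 of the minimum does no harm, because [M >= c0 >= 2]. *)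
  rewrite invf_le1 // EM.
  have : 2%:R <= c0%:R :> rat by rewrite ler_nat.
  by have := cf0_ge0 _ L0p; have := cf0_ge0 _ R0p; lra.
have [m ->] := dnear_attained (n%:R * cf0 s).
rewrite Zval_term //.
have [//|//||L [c [R []]]] := @qcoord_ecoord_ge [::] s m n.
  by rewrite /qcoord /= mul0r mul1r add0r; apply/andP; split; lia.
move=> /esym E; rewrite /qcoord mul0r mul1r add0r => le.
change (catrev [::] s) with s in E.
have [Lp Rp] := splitP _ _ _ E.
have := ub _ _ _ E; rewrite split_value // -E => ub1.
have dLR : 0 < (den L * den R)%:R :> rat by rewrite natrM mulr_gt0 ?dpos.
apply: (@le_trans _ _ ((den L * den R)%:R / (den s)%:R)).
  by rewrite -[_ / _]invf_div lef_pV2 ?posrE // divr_gt0 ?dpos.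
rewrite ler_pM2r ?invr_gt0 ?dpos //.
by rewrite pmulrn ler_int.
Qed.

(** * Values of words and of the cuts of a chain *)

Lemma chain_of_pos (w : word) : all (leq 1) (chain_of w).
Proof. by elim: w => [|[] w IH]. Qed.

Lemma chain_of_rev (w : word) : chain_of (rev w) = rev (chain_of w).
Proof.
elim: w => // x w IH.
rewrite rev_cons /chain_of -cats1 map_cat flatten_cat /= -!/(chain_of _) IH cats0 rev_cat.
by case: x.
Qed.

Local Notation value w := (cf0 (chain_of w)).

Lemma value_ge0 (w : word) : 0 <= value w.
Proof. by rewrite cf0_num_den ?chain_of_pos // divr_ge0. Qed.

(** In this form [value w] occurs once, so bounds on it carry over directly. *)
Lemma value_a (w : word) : value (La :: w) = 1 / 2 - (1 / 2) / (5 + 2 * value w).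
Proof. by have := value_ge0 w => /= H; field; lra. Qed.

Lemma value_b (w : word) : value (Lb :: w) = 1 - 1 / (2 + value w).
Proof. by have := value_ge0 w => /= H; field; lra. Qed.

Lemma value_lt1 (w : word) : value w < 1.
Proof.
case: w => [|[] w] //; rewrite ?value_a ?value_b; have := value_ge0 w => H.
  have : 0 < (1 / 2) / (5 + 2 * value w) :> rat by rewrite divr_gt0 //; lra.
  lra.
have : 0 < 1 / (2 + value w) :> rat by rewrite divr_gt0 //; lra.
lra.
Qed.

Lemma value_b_bounds (w : word) : 1 / 2 <= value (Lb :: w) <= 2 / 3.
Proof.
rewrite value_b; have := value_ge0 w; have := value_lt1 w.
move: (value w) => x x1 x0.
have : 1 / 3 <= 1 / (2 + x) by rewrite ler_pdivlMr; lra.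
have : 1 / (2 + x) <= 1 / 2 by rewrite ler_pdivrMr; lra.
by lra.
Qed.

(** The endpoints correspond to tails of value 0 and 1. Since 3/7 < 1/2, the first letter decides
    the comparison with [value_b_bounds]. *)
Lemma value_a_bounds (w : word) : 2 / 5 <= value (La :: w) <= 3 / 7.
Proof.
rewrite value_a; have := value_ge0 w; have := value_lt1 w.
move: (value w) => x x1 x0.
have : 1 / 14 <= (1 / 2) / (5 + 2 * x) by rewrite ler_pdivlMr; lra.
have : (1 / 2) / (5 + 2 * x) <= 1 / 10 by rewrite ler_pdivrMr; lra.
by lra.
Qed.

Lemma double_step_le (c x y : rat) : 0 < c -> 0 <= x -> x <= y ->
  (c + (c + x)^-1)^-1 <= (c + (c + y)^-1)^-1.
Proof.
move=> c0 x0 xy.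
have cx : 0 < c + x by lra.
have cy : 0 < c + y by lra.
have ix : 0 < (c + x)^-1 by rewrite invr_gt0.
have iy : 0 < (c + y)^-1 by rewrite invr_gt0.
have le : (c + y)^-1 <= (c + x)^-1 by rewrite lef_pV2 // lerD2l.
by rewrite lef_pV2 ?posrE; lra.
Qed.

Lemma value_le (u v : word) : lew u v -> value u <= value v.
Proof.
elim: u v => [|x u IH] v; first by rewrite value_ge0.
case: x; case: v => [|[] v] //.
- by move/IH => /= H; apply: double_step_le; rewrite ?value_ge0.
- by move=> _; have := value_a_bounds u; have := value_b_bounds v; lra.
- by move/IH => /= H; apply: double_step_le; rewrite ?value_ge0.
Qed.

Lemma chain_of_split (w : word) (L R : seq nat) (c : nat) :
  chain_of w = catrev L (c :: R) ->
  exists X l Y d, w = X ++ l :: Y /\ chain_of [:: l] = [:: d; d] /\ c = d /\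
    ((L = chain_of (rev X) /\ R = d :: chain_of Y) \/
     (L = d :: chain_of (rev X) /\ R = chain_of Y)).
Proof.
rewrite catrevE => E.
have y0 : c :: R <> [::] by [].
have [X [l [Y [u [v [-> El v0 EL ER]]]]]] := flatten_map_split E y0.
have [d Ed] : exists d, chain_of [:: l] = [:: d; d].
  by case: l {El}; [exists 2%N | exists 1%N].
exists X, l, Y, d; split=> //; split=> //.
have {}Ed : u ++ v = [:: d; d] by rewrite -El; case: (l) Ed.
rewrite chain_of_rev -[L]revK EL.
case: u Ed {El EL} => [|u0 [|u1 u]] /= Ed.
- by rewrite Ed in ER; case: ER => -> ->; rewrite cats0; split=> //; left.
- case: Ed ER => -> -> /= [-> ->]; split=> //; right.
  by rewrite rev_cat.
- by case: Ed v0 => _ _; case: u => // ->.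
Qed.

(* A cut inside a letter [b] is worth at most [2 + 2/3]; the two kinds of cut
   at a letter [a] are exchanged by the reversal of [C]. *)
Lemma split_le (C Y0 Z0 : word) (L R : seq nat) (c : nat) :
  palindrome (Lb :: C) -> suffixes_between (Lb :: C) (La :: Y0) (Lb :: Z0) ->
  chain_of (Lb :: C) = catrev L (c :: R) ->
  c%:R + cf0 R + cf0 L <= cfi (chain_of (La :: Y0)) + value (Lb :: Z0).
Proof.
move=> pal H E.
have bZ := value_b_bounds Z0.
have -> : cfi (chain_of (La :: Y0)) = 2 + (2 + value Y0)^-1 by [].
(* With [bZ] the right-hand side is at least 2 + 5/6, which beats every cut inside [b]. *)
have yZ : 1 / 3 <= (2 + value Y0)^-1.
  have := value_ge0 Y0; have := value_lt1 Y0 => y1 y0.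
  by rewrite -[_ / _]invf_div lef_pV2 ?posrE; lra.
have cut_a X Y : Lb :: C = X ++ La :: Y ->
    (2 + value Y)^-1 + value (rev X) <= (2 + value Y0)^-1 + value (Lb :: Z0).
  move=> EC.
  have X0 : X <> [::] by move=> X0; rewrite X0 in EC.
  have aY : La :: Y <> [::] by [].
  have /andP[leY _] := H _ _ EC X0 aY.
  have leX : lew (rev X) (Lb :: Z0).
    have EC' : Lb :: C = rcons (rev Y) La ++ rev X by rewrite -pal EC rev_cat rev_cons.
    have YN : rcons (rev Y) La <> [::] by case: (rev Y).
    case: (rev X) EC' => // x X' EC'.
    by have /andP[] : lew (La :: Y0) (x :: X') && lew (x :: X') (Lb :: Z0) by apply: H EC' YN _.
  apply: lerD; last exact: value_le.
  have y0 := value_ge0 Y0; have y1 := value_ge0 Y.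
  by rewrite lef_pV2 ?posrE ?lerD2l; [apply: value_le | lra | lra].
have cut_b X Y : 1 + (1 + value Y)^-1 + value X <= 2 + 2 / 3.
  have : value X <= 2 / 3.
    case: X => [|[] X]; first by rewrite /=; lra.
      by have := value_a_bounds X; lra.
    by have := value_b_bounds X; lra.
  have : (1 + value Y)^-1 <= 1 by have := value_ge0 Y => y0; rewrite invf_le1; lra.
  lra.
have [X [l [Y [d [EC [Ed [-> EX]]]]]]] := chain_of_split E.
have palX : Lb :: C = rev Y ++ l :: rev X by rewrite -pal EC rev_cat rev_cons cat_rcons.
case: l Ed EC palX EX => [[<- _]|[<- _]] EC palX EX.
- case: EX => -[-> ->]; rewrite [cf0 (2%N :: _)]/=.
    by have := cut_a _ _ EC; lra.
  by have := cut_a _ _ palX; rewrite revK; lra.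
- case: EX => -[-> ->]; rewrite [cf0 (1%N :: _)]/=.
    by have := cut_b (rev X) Y; lra.
  by have := cut_b Y (rev X); lra.
Qed.

(** * Powers of a product of two palindromes, and the conclusion *)

Lemma flatten_nseq_comm (T : Type) (k : nat) (u v : seq T) :
  flatten (nseq k (u ++ v)) ++ u = u ++ flatten (nseq k (v ++ u)).
Proof. by elim: k => [|k IH] /=; rewrite ?cats0 // -!catA IH. Qed.

Lemma flatten_nseqSr (T : Type) (k : nat) (w : seq T) :
  w ++ flatten (nseq k w) = flatten (nseq k w) ++ w.
Proof. by have := flatten_nseq_comm k w [::]; rewrite cats0. Qed.

Lemma rev_flatten_nseq (T : Type) (k : nat) (w : seq T) :
  rev (flatten (nseq k w)) = flatten (nseq k (rev w)).
Proof.
by elim: k => //= k IH; rewrite rev_cat IH flatten_nseqSr.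
Qed.

Lemma palindrome_pow (P Q : word) (k : nat) :
  palindrome P -> palindrome Q -> palindrome (Q ++ flatten (nseq k (P ++ Q))).
Proof.
move=> HP HQ.
by rewrite /palindrome rev_cat rev_flatten_nseq rev_cat HP HQ flatten_nseq_comm.
Qed.

Theorem theorem4p7 (ms : seq move) (P1 P2 : word) (k : nat) :
  P1 ++ P2 = Psi ms [:: La; Lb] ->
  P1 <> [::] -> P2 <> [::] -> palindrome P1 -> palindrome P2 ->
  (1 <= k)%N ->
  Zval (cf0 (chain_of (P2 ++ flatten (nseq k (P1 ++ P2))))) =
  (cfi (chain_of (P1 ++ P2)) +
   cf0 (chain_of (P2 ++ flatten (nseq k.-1 (P1 ++ P2)))))^-1.
Proof.
move=> E P10 P20 pal1 pal2.
case: k => // k _; rewrite [k.+1.-1]/=.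
have between := Psi_palindromes_between (k := k) E P10 P20 pal1 pal2.
have palC := palindrome_pow k.+1 pal1 pal2.
have palZ := palindrome_pow k pal1 pal2.
have [w Ew] := Psi_ends ms; rewrite Ew in E.
have [_ _ [Q EQ]] := palindrome_ends E P10 P20 pal1 pal2.
set Z := P2 ++ flatten (nseq k (P1 ++ P2)) in between palZ *.
have EC : P2 ++ flatten (nseq k.+1 (P1 ++ P2)) = Z ++ P1 ++ P2.
  by rewrite /Z /= flatten_nseqSr catA.
apply: Zval_cf0; first exact: chain_of_pos.
  move=> L c R; move: palC between; rewrite /Z {}E EQ; exact: split_le.
(* The maximal cut precedes the last copy of Pi; the prefix [Z] is a palindrome, so it reads the
   same backwards. *)
exists (chain_of Z), 2%N, (2%N :: chain_of (rcons w Lb)).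
split=> //; last by rewrite E.
by rewrite catrevE -chain_of_rev palZ EC E /chain_of map_cat flatten_cat.
Qed.
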